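(* Let $M$ be a discrete $m$-function whose sequence of continued fraction coefficients is eventually periodic, written as \[ \{(\alpha_1,\beta_1),\ldots,(\alpha_k,\beta_k),\overline{(a_1,b_1),\ldots,(a_p,b_p)}\} \] with $k\ge1$ and $(\alpha_k,\beta_k)=(a_p,b_p)$, and let $\widetilde M$ be its second solution. Suppose there exist a sequence $\{(c_n,d_n)\}_{n\ge1}$ with each $c_n>0$, $d_n\in\mathbb{R}$, and $L\in\mathbb{N}$ such that \[ M(z)=\frac{p_L(z)\frac{1}{\alpha_k^2\widetilde M(z)}+q_L(z)}{-c_L\left(p_{L-1}(z)\frac{1}{\alpha_k^2\widetilde M(z)}+q_{L-1}(z)\right)}, \] where $p_L(z)=p_L(z;\{c_j,d_j\}_{j=1}^L)$, $q_L(z)=q_L(z;\{c_j,d_j\}_{j=1}^L)$, $p_{L-1}(z)=p_{L-1}(z;\{c_j,d_j\}_{j=1}^L)$, $q_{L-1}(z)=q_{L-1}(z;\{c_j,d_j\}_{j=1}^L)$. Then the continued fraction coefficients of $M$ are purely periodic and doubly palindromic.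
   Context: A discrete $m$-function is a function $m(z)=\int\frac{d\rho(x)}{x-z}$ on $\mathbb{C}_+=\{z:\operatorname{Im} z>0\}$, where $\rho$ is a probability measure on $\mathbb{R}$ with compact support. Such $m$ has a unique continued fraction expansion \[ m(z)=\cfrac{1}{b_1-z-\cfrac{a_1^2}{b_2-z-\cfrac{a_2^2}{b_3-z-\cdots}}} \] valid on $\mathbb{C}_+$, with bounded sequences $a_n>0$, $b_n\in\mathbb{R}$; the pairs $\{(a_n,b_n)\}_{n\ge1}$ are its continued fraction coefficients. The overline notation means the block $(a_1,b_1),\ldots,(a_p,b_p)$ repeats forever; ''purely periodic'' means the whole coefficient sequence is periodic from the first term on. Orthogonal polynomials: given $a_1,a_2,\ldots>0$, $b_1,b_2,\ldots\in\mathbb{R}$, set $p_{-1}=0$, $p_0=1$ and define $p_{n+1}$ by $zp_n(z)=a_{n+1}p_{n+1}(z)+b_{n+1}p_n(z)+a_np_{n-1}(z)$ for $n\ge0$; $p_n(z;\{a_j,b_j\}_{j=1}^N)$ ($N\ge n$) denotes this polynomial built from the listed coefficients. Second kind polynomials: $q_{-1}=-1$, $q_0=0$, and for $n\ge1$, $q_n(z;\{a_j,b_j\}_{j=1}^N)=\frac{1}{a_1}p_{n-1}(z;\{a_{j},b_{j}\}_{j=2}^N)$. Second solution: there are polynomials $A,B,C\in\mathbb{R}[z]$, $A\ne0$, with $A M^2+BM+C=0$ on $\mathbb{C}_+$ (minimal such relation); $\widetilde M=-B/A-M$ is the other root. Doubly palindromic: a $p$-periodic sequence $\{(a_j,b_j)\}$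 is doubly palindromic (with period $p$ and first length $\ell$, $1\le\ell\le p-2$) if $a_1\cdots a_p$ is the concatenation of palindromes of lengths $\ell$ and $p-\ell$, and $b_1\cdots b_p$ is the concatenation of palindromes of lengths $\ell+1$ and $p-\ell-1$ (a $p$-periodic sequence may also be regarded as $2p$-periodic for this purpose). *)

(* Defs.v *)
From HB Require Import structures.
From mathcomp Require Import all_boot all_order all_algebra.
From mathcomp Require Import complex.
From mathcomp Require Import all_classical all_reals all_analysis.
Set Implicit Arguments. Unset Strict Implicit. Unset Printing Implicit Defensive.
Import Order.TTheory GRing.Theory Num.Theory.
Import numFieldNormedType.Exports.
Local Open Scope ring_scope.
Local Open Scope complex_scope.
Local Open Scope classical_set_scope.

Section Defs.
Variable R : realType.
Local Notation C := (R[i]).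

(* Sequences are 1-indexed functions nat -> R (index 0 unused). *)

Fixpoint cf_trunc (a b : nat -> R) (r n : nat) (z : C) : C :=
  match r with
  | 0 => 0
  | r'.+1 => 1 / ((b n)%:C - z - ((a n) ^+ 2)%:C * cf_trunc a b r' n.+1 z)
  end.

Definition m_function_of (a b : nat -> R) (M : C -> C) : Prop :=
  forall z : C, 0 < Im z ->
    (fun N : nat => (cf_trunc a b N 1 z : (R[i] : numFieldType))) @ \oo
      --> (M z : (R[i] : numFieldType)).

(* Orthogonal polynomials evaluated at z: opair n = (p_{n-1}(z), p_n(z)),
   from z p_n = c_{n+1} p_{n+1} + d_{n+1} p_n + c_n p_{n-1}, p_{-1}=0, p_0=1. *)
Fixpoint opair (c d : nat -> R) (n : nat) (z : C) : C * C :=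
  match n with
  | 0 => (0, 1)
  | n'.+1 => let: (pm, pn) := opair c d n' z in
             (pn, ((z - (d n)%:C) * pn - (c n')%:C * pm) / (c n)%:C)
  end.

Definition porth (c d : nat -> R) (n : nat) (z : C) : C := (opair c d n z).2.

Definition qorth (c d : nat -> R) (n : nat) (z : C) : C :=
  match n with
  | 0 => 0
  | n'.+1 => (1 / (c 1%N)%:C) * porth (fun j => c j.+1) (fun j => d j.+1) n' z
  end.

Definition peval (P : {poly R}) (z : C) : C := (map_poly (real_complex R) P).[z].

Definition minimal_quad_rel (M : C -> C) (A B Cp : {poly R}) : Prop :=
  [/\ A != 0,
      (forall z : C, 0 < Im z ->
         peval A z * M z ^+ 2 + peval B z * M z + peval Cp z = 0)
    & ~ (exists D E : {poly R}, D != 0 /\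
           forall z : C, 0 < Im z -> peval D z * M z + peval E z = 0)].

Definition second_solution (M : C -> C) (A B : {poly R}) (z : C) : C :=
  - (peval B z / peval A z) - M z.

Definition ev_per (alpha a : nat -> R) (k p : nat) (n : nat) : R :=
  if (n <= k)%N then alpha n else a (((n - k - 1) %% p) + 1)%N.

Definition palindrome (f : nat -> R) (s len : nat) : Prop :=
  forall i : nat, (i < len)%N -> f (s + i)%N = f (s + (len - 1 - i))%N.

Definition purely_periodic_with (A B : nat -> R) (q : nat) : Prop :=
  (0 < q)%N /\ forall n : nat, (1 <= n)%N -> A (n + q)%N = A n /\ B (n + q)%N = B n.

Definition doubly_palindromic_with (A B : nat -> R) (q l : nat) : Prop :=
  [/\ purely_periodic_with A B q, (1 <= l)%N, (l + 2 <= q)%N,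
      palindrome A 1 l /\ palindrome A l.+1 (q - l)
    & palindrome B 1 l.+1 /\ palindrome B l.+2 (q - l - 1)].

End Defs.

(* Main.v *)
Require Import Defs.
From HB Require Import structures.
From mathcomp Require Import all_boot all_order all_algebra.
From mathcomp Require Import complex.
From mathcomp Require Import all_classical all_reals all_analysis.
From mathcomp Require Import ring lra zify.
Import Order.TTheory GRing.Theory Num.Theory.
Import numFieldNormedType.Exports.
Local Open Scope ring_scope.
Local Open Scope complex_scope.
Set Implicit Arguments.
Unset Strict Implicit.
Unset Printing Implicit Defensive.

(* On the upper half-plane the tails [M_n] of the continued fraction of [M] are
   bounded by [1 / Im z], so along [z = i y], [y -> +oo], a continued fraction
   determines its coefficients and [M] coincides with no rational function.  In
   particular the conjugate [M'] of [M] satisfies every quadratic relation over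
   [R[z]] that [M] does, so its tails are periodic from the same index on.
   Inverting a tail reverses the direction of the recurrence: the numbers
   [W_n = 1 / (al_(n-1)^2 M'_n)] satisfy
   [W_(n+1) = 1 / (be_n - z - al_(n-1)^2 W_n)].
   The hypothesis says that [W_1] has the continued fraction
   [(d_1,c_1), ..., (d_L,c_L)] followed by [M].  Hence [W_(k+1)] has one expansion
   running through [be_k, ..., be_1, d_1, ..., d_L, be_1, be_2, ...], and another,
   by periodicity, running backwards through the period.  Comparing the two makes
   the sequence purely periodic and invariant under a reflection. *)

(** * Preliminaries: real polynomials at complex points, moduli, one level of a continued
    fraction *)

Lemma real_complexX (R : realType) (x : R) n : (x ^+ n)%:C = x%:C ^+ n.
Proof. exact: rmorphXn. Qed.

Lemma pevalD (R : realType) (P Q : {poly R}) z :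
  peval (P + Q) z = peval P z + peval Q z.
Proof. by rewrite /peval rmorphD hornerD. Qed.

Lemma pevalN (R : realType) (P : {poly R}) z : peval (- P) z = - peval P z.
Proof. by rewrite /peval rmorphN hornerN. Qed.

Lemma pevalM (R : realType) (P Q : {poly R}) z :
  peval (P * Q) z = peval P z * peval Q z.
Proof. by rewrite /peval rmorphM hornerM. Qed.

Lemma pevalC (R : realType) (x : R) z : peval x%:P z = x%:C.
Proof. by rewrite /peval map_polyC hornerC. Qed.

Lemma pevalX (R : realType) (z : R[i]) : peval 'X z = z.
Proof. by rewrite /peval map_polyX hornerX. Qed.

Definition pevalE := (pevalD, pevalN, pevalM, pevalC, pevalX).

Lemma peval_sum (R : realType) (P : {poly R}) z :
  peval P z = \sum_(i < size P) (P`_i)%:C * z ^+ i.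
Proof.
rewrite /peval horner_coef size_map_poly.
by apply: eq_bigr => i _; rewrite coef_map.
Qed.

Lemma norm_real_complex (R : realType) (x : R) : `|x%:C| = `|x|%:C :> R[i].
Proof. by rewrite normc_def /= expr0n addr0 sqrtr_sqr. Qed.

Lemma norm_imag (R : realType) (y : R) : 0 <= y -> `|0 +i* y| = y%:C :> R[i].
Proof. by move=> y0; rewrite normc_def /= expr0n add0r sqrtr_sqr ger0_norm. Qed.

Lemma Im_imag (R : realType) (y : R) : 'Im (0 +i* y) = y%:C.
Proof. by rewrite -complexIm. Qed.

Lemma real_complex_real (R : realType) (x : R) : x%:C \is Num.real.
Proof. by rewrite complex_real. Qed.

Lemma normC_ge_Im (C : numClosedFieldType) (x : C) : `|'Im x| <= `|x|.
Proof.
rewrite -ler_sqr ?nnegrE // (normC2_Re_Im x) real_normK ?Creal_Im //.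
by rewrite lerDr -realEsqr Creal_Re.
Qed.

(** Both [z] and [a ^+ 2 * x] push the imaginary part of [D] downwards, so it is at most [- 'Im z].
    Hence [|D| >= 'Im z], and inversion moves the value back to the closed upper half-plane. *)
Lemma cf_step (R : realType) (b a : R) (z x : R[i]) :
  0 < 'Im z -> 0 <= 'Im x ->
  let D := b%:C - z - (a ^+ 2)%:C * x in
  [/\ D != 0, 0 <= 'Im (1 / D) & `|1 / D| <= ('Im z)^-1].
Proof.
move=> z0 x0 D.
have ImD_ge : 'Im z <= - 'Im D.
  rewrite /D !raddfB /= ImMl ?real_complex_real //.
  have /Creal_ImP -> := real_complex_real b.
  by rewrite oppr0 sub0r !opprK lerDl mulr_ge0 // ler0c sqr_ge0.
have nD0 : 0 < - 'Im D by apply: lt_le_trans ImD_ge.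
have D0 : D != 0 by apply: contraTneq nD0 => ->; rewrite raddf0 oppr0 ltxx.
have nD : 'Im z <= `|D|.
  apply: le_trans (normC_ge_Im D); apply: le_trans ImD_ge _.
  by rewrite -normrN real_ler_norm // rpredN Creal_Im.
rewrite div1r ImV normfV; split=> //.
  by rewrite divr_ge0 ?exprn_ge0 // ltW.
by rewrite lef_pV2 // posrE normr_gt0.
Qed.

(** * Growth of polynomials along the imaginary axis, and irrationality of continued fractions *)

(** The extra factor [y] lets the exponent be a size instead of a degree. A coefficient list is used
    because a polynomial stripped of its leading term may have trailing zeros. *)
Lemma peval_imag_upper (R : realType) (s : seq R) m (y : R) :
  (size s <= m)%N -> 1 <= y ->
  `|\sum_(i < size s) (s`_i)%:C * (0 +i* y) ^+ i| * y%:C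
    <= ((\sum_(i < size s) `|s`_i|) * y ^+ m)%:C.
Proof.
move=> sm y1; have y0 : 0 <= y by lra.
apply: (@le_trans _ _ ((\sum_(i < size s) `|s`_i| * y ^+ i) * y)%:C).
  rewrite rmorphM /= ler_wpM2r ?ler0c //.
  apply: le_trans (ler_norm_sum _ _ _) _.
  rewrite rmorph_sum; apply: ler_sum => i _ /=.
  by rewrite normrM normrX norm_imag // norm_real_complex rmorphM rmorphXn.
rewrite lecR !mulr_suml; apply: ler_sum => i _.
rewrite -mulrA ler_wpM2l // -exprSr ler_weXn2l //.
exact: leq_trans (ltn_ord i) sm.
Qed.

Lemma peval_imag_lower (R : realType) (Q : {poly R}) : Q != 0 ->
  exists2 e : R, 0 < e &
    \forall y \near +oo%R, (e * y ^+ size Q)%:C <= `|peval Q (0 +i* y)| * y%:C.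
Proof.
move=> Q0; have lQ : 0 < `|lead_coef Q| by rewrite normr_gt0 lead_coef_eq0.
exists (`|lead_coef Q| / 2); first by rewrite divr_gt0.
case sQ: (size Q) => [|m]; first by move: Q0; rewrite -size_poly_eq0 sQ.
pose K : R := \sum_(i < m) `|Q`_i|.
near=> y.
have y1 : 1 <= y by near: y; apply: nbhs_pinfty_ge; rewrite num_real.
(* From this point on the lower-order terms amount to at most half of the leading one, whence the
   constant [|lead_coef Q| / 2]. *)
have yK : K <= `|lead_coef Q| / 2 * y.
  by rewrite -ler_pdivrMl ?divr_gt0 //; near: y; apply: nbhs_pinfty_ge; rewrite num_real.
have y0 : 0 <= y by lra.
rewrite peval_sum sQ big_ord_recr /=.
have sm : size (mkseq (fun i => Q`_i) m) = m by rewrite size_mkseq.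
have := @peval_imag_upper R (mkseq (fun i => Q`_i) m) m y.
rewrite sm leqnn => /(_ isT y1).
have E1 : \sum_(i < m) ((mkseq (fun i => Q`_i) m)`_i)%:C * (0 +i* y) ^+ i =
  \sum_(i < m) (Q`_i)%:C * (0 +i* y) ^+ i.
  by apply: eq_bigr => i _; rewrite nth_mkseq.
have E2 : \sum_(i < m) `|(mkseq (fun i => Q`_i) m)`_i| = K.
  by apply: eq_bigr => i _; rewrite nth_mkseq.
rewrite E1 E2; set S := \sum_(i < m) _ => US.
have -> : Q`_m = lead_coef Q by rewrite lead_coefE sQ.
have lT : `|(lead_coef Q)%:C * (0 +i* y) ^+ m| * y%:C = (`|lead_coef Q| * y ^+ m.+1)%:C.
  by rewrite normrM normrX norm_imag // norm_real_complex exprSr !rmorphM rmorphXn /= mulrA.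
set T := _ * _ ^+ m in lT *.
have : `|T| * y%:C <= `|S + T| * y%:C + `|S| * y%:C.
  rewrite -mulrDl ler_wpM2r ?ler0c //.
  by have := ler_normB (S + T) S; rewrite addrC addKr addrC.
rewrite lT => /le_trans.
move=> /(_ _ (lerD (lexx _) US)).
rewrite -lerBlDr -rmorphB /=; apply: le_trans; rewrite lecR.
have ym : 0 <= y ^+ m by rewrite exprn_ge0.
have := ler_wpM2r ym yK; rewrite exprS; nra.
Unshelve. all: by end_near. Qed.

Lemma peval_imag_dominated (R : realType) (P Q : {poly R}) :
  (size P <= size Q)%N -> Q != 0 ->
  exists K : R, \forall y \near +oo%R,
    peval Q (0 +i* y) != 0 /\ `|peval P (0 +i* y)| <= K%:C * `|peval Q (0 +i* y)|.
Proof.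
move=> sPQ Q0; have [e e0 lowQ] := peval_imag_lower Q0.
exists ((\sum_(i < size P) `|P`_i|) / e); near=> y.
have y1 : 1 <= y by near: y; apply: nbhs_pinfty_ge; rewrite num_real.
have y0 : 0 < y by lra.
have lowQy : (e * y ^+ size Q)%:C <= `|peval Q (0 +i* y)| * y%:C by near: y.
split.
  apply: contraTneq lowQy => ->; rewrite normr0 mul0r -real_ltNge ?real_complex_real //.
  by rewrite ltcR mulr_gt0 ?exprn_gt0.
have yC : 0 < y%:C by rewrite ltcR.
rewrite -(ler_pM2r yC) peval_sum -mulrA.
apply: le_trans (peval_imag_upper sPQ y1) _.
have K0 : 0 <= (\sum_(i < size P) `|P`_i|) / e.
  by rewrite divr_ge0 ?(ltW e0) // sumr_ge0.
apply: le_trans (ler_wpM2l _ lowQy); last by rewrite ler0c.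
by rewrite -rmorphM lecR mulrA divfK // gt_eqF.
Unshelve. all: by end_near. Qed.

(* Dividing [P X_n + Q] by [X_n] yields a relation for [X_(n+1)] whose leading
   coefficient is a multiple of [Q]: a Euclidean descent, which stops because
   [X_n (i y)] tends to 0 while [Q / P] does not once [size P <= size Q]. *)
Lemma cf_not_rational (R : realType) (a b : nat -> R) (X : nat -> R[i] -> R[i]) :
  (forall n, a n.+1 != 0) ->
  (forall n z, 0 < 'Im z -> `|X n z| <= ('Im z)^-1) ->
  (forall n z, 0 < 'Im z ->
     X n z * ((b n.+1)%:C - z - (a n.+1 ^+ 2)%:C * X n.+1 z) = 1) ->
  forall (P Q : {poly R}) n, (P != 0) || (Q != 0) ->
  \forall y \near +oo%R, peval P (0 +i* y) * X n (0 +i* y) + peval Q (0 +i* y) != 0.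
Proof.
move=> a0 leX XE P; have [m] := ubnP (size P).
elim: m P => // m IHm P; rewrite ltnS => sPm Q n PQ0.
case: (leqP (size P) (size Q)) => [sPQ|sQP].
  have Q0 : Q != 0.
    apply: contraTneq PQ0 => Q0; move: sPQ.
    by rewrite Q0 size_poly0 leqn0 size_poly_eq0 => /eqP ->; rewrite eqxx.
  have [K nearK] := peval_imag_dominated sPQ Q0; near=> y.
  have y0 : 0 < y by near: y; apply: nbhs_pinfty_gt; rewrite num_real.
  have yK : K < y by near: y; apply: nbhs_pinfty_gt; rewrite num_real.
  have [Qy leP] : peval Q (0 +i* y) != 0 /\
    `|peval P (0 +i* y)| <= K%:C * `|peval Q (0 +i* y)| by near: y.
  have Imy : 'Im (0 +i* y) = y%:C :> R[i] by rewrite Im_imag.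
  have yC : 0 < y%:C by rewrite ltcR.
  have := leX n (0 +i* y); rewrite Imy => /(_ yC) leXy.
  apply/eqP => /eqP; rewrite addr_eq0 => /eqP PXQ.
  have : `|peval Q (0 +i* y)| * y%:C <= K%:C * `|peval Q (0 +i* y)|.
    apply: le_trans leP; rewrite -normrN -PXQ normrM -mulrA ler_piMr //.
    by rewrite -ler_pdivlMr // div1r.
  by rewrite mulrC ler_pM2r ?normr_gt0 // lecR leNgt yK.
have P0 : P != 0 by rewrite -size_poly_gt0; apply: leq_ltn_trans sQP.
pose P' := - (a n.+1 ^+ 2)%:P * Q; pose Q' := P + Q * ((b n.+1)%:P - 'X).
have a2 : a n.+1 ^+ 2 != 0 by rewrite expf_neq0.
have sP' : (size P' < m)%N.
  rewrite /P' -polyCN size_Cmul ?oppr_eq0 //; exact: leq_trans sQP sPm.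
have PQ'0 : (P' != 0) || (Q' != 0).
  have [Q0|Q0] := eqVneq Q 0; first by rewrite /Q' Q0 mul0r addr0 P0 orbT.
  by rewrite /P' mulf_neq0 // oppr_eq0 polyC_eq0.
have nearX := IHm _ sP' _ n.+1 PQ'0; near=> y.
have y0 : 0 < y by near: y; apply: nbhs_pinfty_gt; rewrite num_real.
have : peval P' (0 +i* y) * X n.+1 (0 +i* y) + peval Q' (0 +i* y) != 0 by near: y.
have := XE n (0 +i* y); rewrite Im_imag ltcR => /(_ y0).
rewrite /P' /Q' !pevalE; set z := 0 +i* y.
move: (X n z) (X n.+1 z) => x x' xx'; apply: contra_neq => E.
have : x * (peval P z + peval Q z * ((b n.+1)%:C - z - (a n.+1 ^+ 2)%:C * x')) = 0.
  by rewrite mulrDr mulrCA xx' mulr1 mulrC.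
move/eqP; rewrite mulf_eq0 => /orP[/eqP x0|/eqP <-]; last by ring.
by move: xx'; rewrite x0 mul0r => /esym/eqP; rewrite oner_eq0.
Unshelve. all: by end_near. Qed.

(** * Truncations and tails of a convergent continued fraction *)

Lemma cf_trunc_bound (R : realType) (a b : nat -> R) r n (z : R[i]) : 0 < 'Im z ->
  0 <= 'Im (cf_trunc a b r n z) /\ `|cf_trunc a b r n z| <= ('Im z)^-1.
Proof.
move=> z0; elim: r n => [|r IHr] n /=.
  by rewrite raddf0 normr0 invr_ge0 lexx ltW.
by have [IH _] := IHr n.+1; have [] := cf_step (b n) (a n) z0 IH.
Qed.

Lemma cf_trunc_step (R : realType) (a b : nat -> R) r n (z : R[i]) : 0 < 'Im z ->
  cf_trunc a b r.+1 n z *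
    ((b n)%:C - z - (a n ^+ 2)%:C * cf_trunc a b r n.+1 z) = 1.
Proof.
move=> z0; have [IH _] := cf_trunc_bound a b r n.+1 z0.
by have [D0 _ _] := cf_step (b n) (a n) z0 IH; rewrite /= divfK.
Qed.

Lemma Im_cvg_ge0 (R : realType) (u : nat -> (R[i] : numFieldType)) (x : (R[i] : numFieldType)) :
  (forall n, 0 <= 'Im (u n)) -> (u @ \oo --> x)%classic -> 0 <= 'Im x.
Proof.
move=> u0 /cvgrPdist_lt ux.
rewrite real_leNgt ?Creal_Im //; apply/negP => x0.
have /ux [N _ /(_ N (leqnn _))] : 0 < - 'Im x by rewrite oppr_gt0.
apply/negP; rewrite -real_leNgt ?rpredN ?Creal_Im ?normr_real //.
apply: le_trans (normC_ge_Im _); rewrite raddfB /= distrC.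
by apply: le_trans (real_ler_norm _); rewrite ?rpredB ?Creal_Im // lerDr.
Qed.

(** Each nonempty truncation is the inverse of a denominator of modulus less than a fixed [K], so
    the truncations stay away from 0. *)
Lemma cf_trunc_cvg_neq0 (R : realType) (a b : nat -> R) n (z : R[i])
    (x : (R[i] : numFieldType)) :
  0 < 'Im z ->
  ((fun r => cf_trunc a b r n z : (R[i] : numFieldType)) @ \oo --> x)%classic ->
  x != 0.
Proof.
move=> z0 /cvgrPdist_lt ux; apply/eqP => x0.
pose K := `|(b n)%:C - z| + `|(a n ^+ 2)%:C| * ('Im z)^-1 + 1.
have K0 : 0 < K.
  by rewrite ltr_wpDl // addr_ge0 // mulr_ge0 // invr_ge0 ltW.
have /ux [N _ /(_ N.+1 (leqnSn _))] : 0 < K^-1 by rewrite invr_gt0.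
rewrite x0 sub0r normrN => tK.
have [_ tb] := cf_trunc_bound a b N n.+1 z0.
have := cf_trunc_step a b N n z0 => /(congr1 Num.norm); rewrite normrM normr1.
apply/eqP; rewrite lt_eqF //.
apply: le_lt_trans (_ : `|cf_trunc a b N.+1 n z| * K < 1); last first.
  by rewrite -ltr_pdivlMr // div1r.
rewrite ler_wpM2l //; apply: le_trans (ler_normB _ _) _.
by rewrite /K -addrA lerD2l ler_wpDr // normrM ler_wpM2l.
Qed.

(** The recurrence solved for the next tail: index [n] is the tail that begins with the coefficients
    of index [n.+1]. *)
Fixpoint cf_tail (R : realType) (a b : nat -> R) (x z : R[i]) n : R[i] :=
  if n is m.+1 then ((b n)%:C - z - 1 / cf_tail a b x z m) / (a n ^+ 2)%:C else x.

(** Convergence is assumed only for the whole fraction. It passes to the next tail by solving one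
    level of the recurrence, which is continuous because the limit already obtained is nonzero. *)
Lemma cf_tail_cvg (R : realType) (a b : nat -> R) (M : R[i] -> R[i]) :
  (forall n, a n.+1 != 0) -> m_function_of a b M -> forall n (z : R[i]), 0 < 'Im z ->
  ((fun r => cf_trunc a b r n.+1 z : (R[i] : numFieldType)) @ \oo
    --> (cf_tail a b (M z) z n : (R[i] : numFieldType)))%classic.
Proof.
move=> a0 MM n z z0; elim: n => [|n IHn]; first exact: MM.
have x0 := cf_trunc_cvg_neq0 z0 IHn.
have a2 : (a n.+1 ^+ 2)%:C != 0 :> R[i].
  by rewrite fmorph_eq0 expf_neq0.
have E r : cf_trunc a b r n.+2 z =
    ((b n.+1)%:C - z - 1 / cf_trunc a b r.+1 n.+1 z) / (a n.+1 ^+ 2)%:C.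
  have := cf_trunc_step a b r n.+1 z0; set t := cf_trunc _ _ r.+1 _ _.
  move=> tE; have t0 : t != 0.
    by apply/eqP => t0; move: tE; rewrite t0 mul0r => /esym/eqP; rewrite oner_eq0.
  have -> : 1 / t = (b n.+1)%:C - z - (a n.+1 ^+ 2)%:C * cf_trunc a b r n.+2 z.
    by rewrite -tE mulrC mulKf.
  by rewrite subKr mulrC mulKf.
under eq_fun do rewrite E /=.
apply: cvgM; last exact: cvg_cst.
apply: cvgB; first exact: cvg_cst.
under eq_fun do rewrite div1r.
rewrite div1r; apply: cvgV => //.
(* A truncation of depth [r] at one level comes from depth [r.+1] at the level before. *)
by rewrite -cvg_shiftS in IHn.
Qed.

Lemma cf_trunc_eq (R : realType) (a b a' b' : nat -> R) r n n' (z : R[i]) :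
  (forall i, a (n + i)%N = a' (n' + i)%N) -> (forall i, b (n + i)%N = b' (n' + i)%N) ->
  cf_trunc a b r n z = cf_trunc a' b' r n' z.
Proof.
elim: r n n' => // r IHr n n' aE bE /=.
have := aE 0%N; have := bE 0%N; rewrite !addn0 => -> ->.
rewrite (IHr n.+1 n'.+1) // => i; by rewrite !addSnnS.
Qed.

Lemma cf_tail_bound (R : realType) (a b : nat -> R) (M : R[i] -> R[i]) n (z : R[i]) :
  (forall n, a n.+1 != 0) -> m_function_of a b M -> 0 < 'Im z ->
  let x := cf_tail a b (M z) z in
  [/\ 0 <= 'Im (x n), `|x n| <= ('Im z)^-1 &
      x n * ((b n.+1)%:C - z - (a n.+1 ^+ 2)%:C * x n.+1) = 1].
Proof.
move=> a0 MM z0 x.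
have Im_x i : 0 <= 'Im (x i).
  apply: Im_cvg_ge0 (cf_tail_cvg a0 MM (n := i) z0) => r.
  by have [] := cf_trunc_bound a b r i.+1 z0.
have x0 : x n != 0 := cf_trunc_cvg_neq0 z0 (cf_tail_cvg a0 MM (n := n) z0).
have a2 : (a n.+1 ^+ 2)%:C != 0 :> R[i] by rewrite fmorph_eq0 expf_neq0.
have xE : (b n.+1)%:C - z - (a n.+1 ^+ 2)%:C * x n.+1 = 1 / x n.
  by rewrite /x /= mulrC divfK // subKr.
split; rewrite ?xE ?mulrA ?mulr1 ?divff //.
have [_ _] := cf_step (b n.+1) (a n.+1) z0 (Im_x n.+1).
by rewrite xE !div1r invrK.
Qed.

(** The two tails are limits of the same truncations. *)
Lemma cf_tail_periodic (R : realType) (a b : nat -> R) (M : R[i] -> R[i]) k p (z : R[i]) :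
  (forall n, a n.+1 != 0) -> m_function_of a b M -> 0 < 'Im z ->
  (forall n, (k <= n)%N -> a (n + p)%N = a n) ->
  (forall n, (k <= n)%N -> b (n + p)%N = b n) ->
  cf_tail a b (M z) z (k + p) = cf_tail a b (M z) z k.
Proof.
move=> a0 MM z0 aP bP.
have := cf_tail_cvg a0 MM (n := k) z0; have := cf_tail_cvg a0 MM (n := (k + p)%N) z0.
have E r : cf_trunc a b r (k + p).+1 z = cf_trunc a b r k.+1 z.
  have Ei i : ((k + p).+1 + i = k.+1 + i + p)%N by lia.
  by apply: cf_trunc_eq => i; rewrite Ei ?aP ?bP //; lia.
under eq_fun do rewrite E.
exact: cvg_unique.
Qed.

(** * Tails as fractional linear functions of [M], and the conjugate root *)

(** Numerator and denominator of [cf_tail], kept apart so that both are linear in [x] with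
    polynomial coefficients. *)
Fixpoint tail_frac (R : realType) (a b : nat -> R) (x z : R[i]) n : R[i] * R[i] :=
  if n is m.+1 then
    let: (u, v) := tail_frac a b x z m in
    (((b n)%:C - z) * u - v, (a n ^+ 2)%:C * u)
  else (x, 1).

Lemma tail_frac_linear (R : realType) (a b : nat -> R) n :
  exists P Q P' Q' : {poly R}, forall x z, tail_frac a b x z n =
    (peval P z * x + peval Q z, peval P' z * x + peval Q' z).
Proof.
elim: n => [|n [P [Q [P' [Q' E]]]]].
  exists 1%:P, 0%:P, 0%:P, 1%:P => x z /=.
  by rewrite !pevalC mul1r addr0 mul0r add0r.
exists (((b n.+1)%:P - 'X) * P - P'), (((b n.+1)%:P - 'X) * Q - Q'),
  ((a n.+1 ^+ 2)%:P * P), ((a n.+1 ^+ 2)%:P * Q) => x z /=.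
by rewrite E !pevalE; congr pair; ring.
Qed.

Lemma tail_fracP (R : realType) (a b : nat -> R) (z : R[i]) (x : nat -> R[i]) n :
  (forall n, a n.+1 != 0) ->
  (forall n, x n * ((b n.+1)%:C - z - (a n.+1 ^+ 2)%:C * x n.+1) = 1) ->
  let: (u, v) := tail_frac a b (x 0%N) z n in v != 0 /\ x n * v = u.
Proof.
move=> a0 xE; elim: n => [|n] /=; first by rewrite mulr1 oner_neq0.
case: (tail_frac _ _ _ _ _) => u v [v0 xv].
have x0 : x n != 0.
  by apply/eqP => x0; have := xE n; rewrite x0 mul0r => /esym/eqP; rewrite oner_eq0.
split; first by rewrite -xv !mulf_neq0 // fmorph_eq0 expf_neq0.
rewrite -[v in RHS]mul1r -(xE n) -xv; ring.
Qed.

(** Cross-multiplying two fractional linear expressions in [x 0] gives a quadratic one. Since [U],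
    [V], [W] are chosen before the solution [x], the relation can be moved from [M] to its
    conjugate. *)
Lemma cf_tail_eq_quadratic (R : realType) (a b : nat -> R) m n :
  (forall n, a n.+1 != 0) ->
  exists U V W : {poly R}, forall (z : R[i]) (x : nat -> R[i]),
    (forall n, x n * ((b n.+1)%:C - z - (a n.+1 ^+ 2)%:C * x n.+1) = 1) ->
    (x m == x n) = (peval U z * x 0%N ^+ 2 + peval V z * x 0%N + peval W z == 0).
Proof.
move=> a0; have [P [Q [P' [Q' E]]]] := tail_frac_linear a b m.
have [S [T [S' [T' F]]]] := tail_frac_linear a b n.
exists (P * S' - S * P'), (P * T' + Q * S' - S * Q' - T * P'), (Q * T' - T * Q').
move=> z x xE.
have := tail_fracP m a0 xE; have := tail_fracP n a0 xE.
rewrite E F !pevalE => -[v0 uE] [v0' uE'].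
rewrite -subr_eq0 -(mulIr_eq0 _ (mulIf v0)) -(mulIr_eq0 _ (mulIf v0')).
congr (_ == 0); rewrite !mulrBl -mulrA [_ * (_ * _)]mulrCA [x m * _]mulrC.
rewrite [x n * _]uE [X in _ * X - _]mulrC uE'; ring.
Qed.

Lemma quadratic_conjugate (R : realType) (M : R[i] -> R[i]) (A B C U V W : {poly R}) :
  (forall P Q : {poly R}, (P != 0) || (Q != 0) ->
     \forall y \near +oo%R, peval P (0 +i* y) * M (0 +i* y) + peval Q (0 +i* y) != 0) ->
  A != 0 ->
  (\forall y \near +oo%R, let z := 0 +i* y in
     peval A z * M z ^+ 2 + peval B z * M z + peval C z = 0) ->
  (\forall y \near +oo%R, let z := 0 +i* y in
     peval U z * M z ^+ 2 + peval V z * M z + peval W z = 0) ->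
  \forall y \near +oo%R, let z := 0 +i* y in let M' := second_solution M A B z in
    peval U z * M' ^+ 2 + peval V z * M' + peval W z = 0.
Proof.
move=> irr A0 nearA nearU.
(* Eliminating the square of [M] from the two relations leaves a relation linear in [M], which must
   be trivial. The two quadratics are therefore proportional and share both roots. *)
have [/eqP E1 /eqP E2] : A * V - U * B == 0 /\ A * W - U * C == 0.
  apply/andP; rewrite -[_ && _]negbK negb_and; apply/negP => /irr nearN.
  have [y [/= nE EA EU]] : exists y, [/\
      peval (A * V - U * B) (0 +i* y) * M (0 +i* y) + peval (A * W - U * C) (0 +i* y) != 0,
      peval A (0 +i* y) * M (0 +i* y) ^+ 2 + peval B (0 +i* y) * M (0 +i* y)
        + peval C (0 +i* y) = 0 &
      peval U (0 +i* y) * M (0 +i* y) ^+ 2 + peval V (0 +i* y) * M (0 +i* y)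
        + peval W (0 +i* y) = 0].
    apply: (@filter_ex _ (pinfty_nbhs R)); near=> y; split; last first.
    - by near: y.
    - by near: y.
    - by near: y.
  move/eqP: nE; apply; move: EA EU; rewrite !pevalE; set z := 0 +i* y => EA EU.
  transitivity (peval A z * 0 - peval U z * 0); last by rewrite !mulr0 subrr.
  by rewrite -{1}EU -EA; ring.
have nearA0 := irr 0 A; rewrite A0 orbT in nearA0; have {}nearA0 := nearA0 isT.
near=> y.
have Ay : peval A (0 +i* y) != 0.
  have : peval 0 (0 +i* y) * M (0 +i* y) + peval A (0 +i* y) != 0 by near: y.
  by rewrite -polyC0 pevalC mul0r add0r.
have EA : peval A (0 +i* y) * M (0 +i* y) ^+ 2 + peval B (0 +i* y) * M (0 +i* y)
    + peval C (0 +i* y) = 0 by near: y.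
set z := 0 +i* y in Ay EA *; set M' := second_solution M A B z.
apply: (mulfI Ay); rewrite mulr0.
have := congr1 (fun P => peval P z) E1; have := congr1 (fun P => peval P z) E2.
rewrite -polyC0 !pevalE => /subr0_eq EW /subr0_eq EV.
have AM' : peval A z * M' = - peval B z - peval A z * M z.
  by rewrite /M' /second_solution mulrBr mulrN mulrCA divff // mulr1.
move: M' AM' => M' AM'.
transitivity (peval U z * (M' * (peval A z * M') + peval B z * M' + peval C z)).
  rewrite !mulrDr [peval A z * (peval V z * _)]mulrA EV EW; ring.
rewrite AM' -[RHS](mulr0 (peval U z)) -EA; congr (_ * _).
transitivity (- M z * (peval A z * M') + peval C z); first by ring.
rewrite AM'; ring.
Unshelve. all: by end_near. Qed.

(** * Orthogonal polynomials and finite continued fractions *)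

Lemma opairS (R : realType) (c d : nat -> R) n (z : R[i]) :
  opair c d n.+1 z = (porth c d n z,
    ((z - (d n.+1)%:C) * porth c d n z - (c n)%:C * (opair c d n z).1) / (c n.+1)%:C).
Proof. by rewrite /porth /=; case: (opair c d n z). Qed.

Lemma porth_rec (R : realType) (c d : nat -> R) n (z : R[i]) : c n.+2 != 0 ->
  (c n.+2)%:C * porth c d n.+2 z =
    (z - (d n.+2)%:C) * porth c d n.+1 z - (c n.+1)%:C * porth c d n z.
Proof.
move=> c0; have -> : porth c d n z = (opair c d n.+1 z).1 by rewrite opairS.
by rewrite {1}/porth opairS mulrC divfK ?fmorph_eq0.
Qed.

Lemma qorth_rec (R : realType) (c d : nat -> R) n (z : R[i]) : c n.+2 != 0 ->
  (c n.+2)%:C * qorth c d n.+2 z =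
    (z - (d n.+2)%:C) * qorth c d n.+1 z - (c n.+1)%:C * qorth c d n z.
Proof.
move=> c0; pose c' j := c j.+1; pose d' j := d j.+1.
rewrite [qorth c d n.+2 z]/qorth -/c' -/d' {1}/porth opairS [(_, _).2]/=.
(* For [n = 0] the component is [p_(-1) = 0] of the shifted family, which agrees with [q_0 = 0]. *)
have -> : (opair c' d' n z).1 = if n is m.+1 then porth c' d' m z else 0.
  by case: n c0 => // n _; rewrite opairS.
rewrite mulrCA [X in _ * X]mulrC divfK ?fmorph_eq0 //.
case: n c0 => [|n] _; rewrite ?mulr0 ?subr0 /c' /=; ring.
Qed.

(** The exact size is carried through the induction because it shows that [P] is nonzero. *)
Lemma porth_poly (R : realType) (c d : nat -> R) n : (forall n, c n.+1 != 0) ->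
  exists P P' : {poly R}, [/\ size P = n.+1, (size P' <= n)%N &
    forall z, opair c d n z = (peval P' z, peval P z)].
Proof.
move=> c0; elim: n => [|n [P [P' [sP sP' E]]]].
  exists 1%:P, 0%:P; split; rewrite ?size_polyC ?oner_neq0 ?eqxx // => z.
  by rewrite !pevalC.
have P0 : P != 0 by rewrite -size_poly_gt0 sP.
have sPX : size (P * ('X - (d n.+1)%:P)) = n.+2.
  by rewrite size_Mmonic ?monicXsubC // sP size_XsubC addn2.
exists ((c n.+1)^-1%:P * (P * ('X - (d n.+1)%:P) - (c n)%:P * P')), P; split.
- rewrite size_Cmul ?invr_eq0 // size_polyDl ?sPX // size_polyN mul_polyC.
  by apply: leq_ltn_trans (size_scale_leq _ _) _; rewrite ltnW.
- by rewrite sP.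
- move=> z; rewrite opairS /porth E !pevalE /= fmorphV; congr pair.
  by rewrite [RHS]mulrC; congr (_ * _); rewrite mulrC.
Qed.

Lemma porth_qorth_poly (R : realType) (c d : nat -> R) n : (forall n, c n.+1 != 0) ->
  exists P Q : {poly R}, P != 0 /\
    forall z, porth c d n z = peval P z /\ qorth c d n z = peval Q z.
Proof.
move=> c0; have [P [P' [sP _ PE]]] := porth_poly d n c0.
have P0 : P != 0 by rewrite -size_poly_gt0 sP.
case: n sP PE => [|n] _ PE.
  by exists P, 0%:P; split=> // z; rewrite pevalC /porth PE.
have [Q [Q' [_ _ QE]]] := @porth_poly R (fun j => c j.+1) (fun j => d j.+1) n (fun j => c0 j.+1).
exists P, ((c 1%N)^-1%:P * Q); split=> // z.
by rewrite !pevalE /= div1r fmorphV /porth PE QE.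
Qed.

Fixpoint cf_ext (R : realType) (a b : nat -> R) r n (x z : R[i]) : R[i] :=
  if r is s.+1 then 1 / ((b n)%:C - z - (a n ^+ 2)%:C * cf_ext a b s n.+1 x z) else x.

(** [cf_ext] unfolds at the outermost level, whereas the recurrence of the orthogonal polynomials
    adds the innermost one. *)
Lemma cf_extS (R : realType) (a b : nat -> R) r n (x z : R[i]) :
  cf_ext a b r.+1 n x z =
    cf_ext a b r n (1 / ((b (n + r)%N)%:C - z - (a (n + r)%N ^+ 2)%:C * x)) z.
Proof.
elim: r n => [|r IHr] n; first by rewrite addn0.
by rewrite [LHS]/= -/(cf_ext a b r.+1 n.+1 x z) IHr /= !addSnnS.
Qed.

Lemma cf_ext_bound (R : realType) (a b : nat -> R) r n (x z : R[i]) :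
  0 < 'Im z -> 0 <= 'Im x -> let y := cf_ext a b r n x z in
  0 <= 'Im y /\ (`|x| <= ('Im z)^-1 -> `|y| <= ('Im z)^-1).
Proof.
move=> z0 x0; elim: r n => [|r IHr] n //=.
by have [IH _] := IHr n.+1; have [_ ? ?] := cf_step (b n) (a n) z0 IH.
Qed.

Lemma cf_ext_rel (R : realType) (a b : nat -> R) r n (x z : R[i]) :
  0 < 'Im z -> 0 <= 'Im x ->
  cf_ext a b r.+1 n x z *
    ((b n)%:C - z - (a n ^+ 2)%:C * cf_ext a b r n.+1 x z) = 1.
Proof.
move=> z0 x0; have [IH _] := cf_ext_bound a b r n.+1 z0 x0.
by have [D0 _ _] := cf_step (b n) (a n) z0 IH; rewrite /= divfK.
Qed.

(* The map [w |-> (p_L w + q_L) / (- c_L (p_(L-1) w + q_(L-1)))] strips the first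
   [L] levels off the continued fraction of [w]. *)
Lemma mobius_cf_ext (R : realType) (c d : nat -> R) (z w : R[i]) :
  (forall n, c n.+1 != 0) -> 0 < 'Im z -> forall L x, 0 <= 'Im x ->
  porth c d L.+1 z * w + qorth c d L.+1 z =
    - (c L.+1)%:C * (porth c d L z * w + qorth c d L z) * x ->
  w = cf_ext c d L.+1 1 x z.
Proof.
move=> c0 z0; have cC n : (c n.+1)%:C != 0 :> R[i] by rewrite fmorph_eq0.
elim=> [|L IHL] x x0 E.
  have [D0 _ _] := cf_step (d 1%N) (c 1%N) z0 x0.
  apply: (mulIf D0); rewrite /= divfK //.
  have P1 : porth c d 1 z * (c 1%N)%:C = z - (d 1%N)%:C.
    by rewrite /porth /= mulr0 subr0 mulr1 divfK.
  have Q1 : qorth c d 1 z * (c 1%N)%:C = 1 by rewrite /qorth /porth /= mulr1 divfK.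
  have P0 : porth c d 0 z = 1 by [].
  move: (congr1 ( *%R^~ (c 1%N)%:C) E); rewrite mulrDl mulrAC P1 Q1 P0 /= addr0 mul1r.
  move/eqP; rewrite -subr_eq0 => /eqP H.
  by apply/eqP; rewrite -subr_eq0 -oppr_eq0 -H real_complexX; apply/eqP; ring.
have [_ y0 _] := cf_step (d L.+2) (c L.+2) z0 x0.
(* Absorbing the innermost level into [x] lowers [L] by one; the three-term recurrences turn [E]
   into the hypothesis required there. *)
rewrite cf_extS add1n; apply: IHL => //.
have [D0 _ _] := cf_step (d L.+2) (c L.+2) z0 x0.
rewrite div1r; apply: (mulIf D0); rewrite [RHS]mulfVK //.
have P := porth_rec d z (c0 L.+1); have Q := qorth_rec d z (c0 L.+1).
have := congr1 ( *%R (c L.+2)%:C) E; rewrite mulrDr mulrA P Q real_complexX.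
move=> H; apply/eqP; rewrite -subr_eq0; move/eqP: H; rewrite -subr_eq0 => /eqP H.
by rewrite -oppr_eq0 -H; apply/eqP; ring.
Qed.

(** * Uniqueness of the continued fraction coefficients *)

Lemma eq0_near_bounded (R : realType) (t K : R) :
  (\forall y \near +oo%R, `|t| * y <= K) -> t = 0.
Proof.
move=> tK; apply/eqP; apply: contraT => t0; have nt0 : 0 < `|t| by rewrite normr_gt0.
have [y [/= ty]] : exists y, `|t| * y <= K /\ K / `|t| < y.
  apply: (@filter_ex _ (pinfty_nbhs R)); near=> y; split; near: y => //.
  by apply: nbhs_pinfty_gt; rewrite num_real.
by rewrite ltr_pdivrMr // mulrC ltNge ty.
Unshelve. all: by end_near. Qed.

(** Cancelling [X] equates the two denominators. The tails decay like [1 / y], which isolates [b];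
    then [a ^+ 2 * X1] is common to both sides, and one further level compares the factors
    [a ^+ 2]. *)
Lemma cf_unique_step (R : realType) (a b a' b' a1 b1 a1' b1' : R)
    (X X1 X2 X1' X2' : R -> R[i]) : 0 < a -> 0 < a' ->
  (\forall y \near +oo%R, let z := 0 +i* y in
     [/\ X y * (b%:C - z - (a ^+ 2)%:C * X1 y) = 1,
         X y * (b'%:C - z - (a' ^+ 2)%:C * X1' y) = 1,
         X1 y * (b1%:C - z - (a1 ^+ 2)%:C * X2 y) = 1 &
         X1' y * (b1'%:C - z - (a1' ^+ 2)%:C * X2' y) = 1] /\
     [/\ `|X1 y| <= (y%:C)^-1, `|X1' y| <= (y%:C)^-1,
         `|X2 y| <= (y%:C)^-1 & `|X2' y| <= (y%:C)^-1]) ->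
  [/\ a = a', b = b' & \forall y \near +oo%R, X1 y = X1' y].
Proof.
move=> a0 a0' nearX.
have nearE : \forall y \near +oo%R,
    b%:C - (a ^+ 2)%:C * X1 y = b'%:C - (a' ^+ 2)%:C * X1' y.
  near=> y.
  have [//|[E E' _ _] _] := near nearX y.
  have X0 : X y != 0.
    by apply/eqP => X0; move: E; rewrite X0 mul0r => /esym/eqP; rewrite oner_eq0.
  apply: (addIr (- (0 +i* y))); rewrite ![_ - _ - (0 +i* y)]addrAC.
  by apply: (mulfI X0); rewrite E E'.
have bb : b = b'.
  apply/subr0_eq/(@eq0_near_bounded _ _ (a ^+ 2 + a' ^+ 2)); near=> y.
  have y0 : 0 < y by near: y; apply: nbhs_pinfty_gt; rewrite num_real.
  have yC : 0 < y%:C by rewrite ltcR.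
  have [//|_ [B1 B1' _ _]] := near nearX y.
  have E : b%:C - (a ^+ 2)%:C * X1 y = b'%:C - (a' ^+ 2)%:C * X1' y by near: y.
  rewrite -lecR rmorphM /= -norm_real_complex -ler_pdivlMr // rmorphB rmorphD /=.
  have -> : b%:C - b'%:C = (a ^+ 2)%:C * X1 y - (a' ^+ 2)%:C * X1' y :> R[i].
    move/eqP: E; rewrite -subr_eq0 => /eqP E; apply/eqP.
    by rewrite -subr_eq0 -E; apply/eqP; ring.
  apply: le_trans (ler_normB _ _) _; rewrite mulrDl !normrM !norm_real_complex.
  by apply: lerD; rewrite (ger0_norm (sqr_ge0 _)) ler_wpM2l // ler0c sqr_ge0.
have nearE2 : \forall y \near +oo%R, (a ^+ 2)%:C * X1 y = (a' ^+ 2)%:C * X1' y.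
  near=> y.
  have : b%:C - (a ^+ 2)%:C * X1 y = b'%:C - (a' ^+ 2)%:C * X1' y by near: y.
  by rewrite bb => /addrI/oppr_inj.
have aa2 : a ^+ 2 = a' ^+ 2.
  apply/subr0_eq.
  (* Bounds what is left of [E] below once the terms in [z] are isolated, using [|t|, |t'| <= 1],
     valid for [y >= 1]. *)
  pose K := a ^+ 2 * (`|b1'| + a1' ^+ 2) + a' ^+ 2 * (`|b1| + a1 ^+ 2).
  apply: (@eq0_near_bounded _ _ K); near=> y.
  have y1 : 1 <= y by near: y; apply: nbhs_pinfty_ge; rewrite num_real.
  have y0 : 0 < y by lra.
  have [//|[_ _ E1 E1'] [_ _ B2 B2']] := near nearX y.
  have E2 : (a ^+ 2)%:C * X1 y = (a' ^+ 2)%:C * X1' y by near: y.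
  have yV : (y%:C)^-1 <= 1 :> R[i] by rewrite invf_le1 ?ltcR // -[1]/(1%:C) lecR.
  move: E1 E1' E2 (le_trans B2 yV) (le_trans B2' yV); set z := 0 +i* y.
  move: (X1 y) (X1' y) (X2 y) (X2' y) => x x' t t' E1 E1' E2 lt lt'.
  have E : (a ^+ 2)%:C * (b1'%:C - z - (a1' ^+ 2)%:C * t') =
           (a' ^+ 2)%:C * (b1%:C - z - (a1 ^+ 2)%:C * t).
    rewrite -[LHS]mul1r -[RHS]mul1r -{1}E1 -E1'.
    transitivity ((a ^+ 2)%:C * x * (b1%:C - z - (a1 ^+ 2)%:C * t) *
      (b1'%:C - z - (a1' ^+ 2)%:C * t')); first by ring.
    by rewrite E2; ring.
  rewrite -lecR rmorphM /= -norm_real_complex -(norm_imag (ltW y0)) -normrM rmorphB /=.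
  have -> : ((a ^+ 2)%:C - (a' ^+ 2)%:C) * (0 +i* y) =
      (a ^+ 2)%:C * (b1'%:C - (a1' ^+ 2)%:C * t') -
      (a' ^+ 2)%:C * (b1%:C - (a1 ^+ 2)%:C * t).
    move/eqP: E; rewrite -subr_eq0 => /eqP E; apply/eqP.
    by rewrite -/z -subr_eq0 -oppr_eq0 -E; apply/eqP; ring.
  have bnd (u v w : R) (s : R[i]) : `|s| <= 1 ->
      `|(u ^+ 2)%:C * (v%:C - (w ^+ 2)%:C * s)| <= (u ^+ 2 * (`|v| + w ^+ 2))%:C.
    move=> s1; rewrite normrM norm_real_complex (ger0_norm (sqr_ge0 _)) [leRHS]rmorphM /=.
    rewrite ler_wpM2l ?ler0c ?sqr_ge0 //.
    apply: le_trans (ler_normB _ _) _.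
    rewrite normrM !norm_real_complex rmorphD lerD2l /= (ger0_norm (sqr_ge0 _)).
    by rewrite ler_piMr // ler0c sqr_ge0.
  apply: le_trans (ler_normB _ _) _; rewrite /K rmorphD /=.
  by apply: lerD; apply: bnd.
have aa : a = a' by apply/eqP; rewrite -(@eqrXn2 _ 2) ?ltW //; apply/eqP.
split=> //; near=> y.
have : (a ^+ 2)%:C * X1 y = (a' ^+ 2)%:C * X1' y by near: y.
by rewrite aa => /mulfI; apply; rewrite fmorph_eq0 expf_neq0 // gt_eqF.
Unshelve. all: by end_near. Qed.

(** Comparing the coefficients at [j] uses the relations at both [j] and [j.+1], so the last level
    yields no conclusion. *)
Lemma cf_unique (R : realType) (a b a' b' : nat -> R) (X X' : nat -> R -> R[i]) J :
  (forall j, (j < J)%N -> 0 < a j /\ 0 < a' j) ->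
  (\forall y \near +oo%R, X 0%N y = X' 0%N y) ->
  (\forall y \near +oo%R, let z := 0 +i* y in forall j, (j < J)%N ->
     [/\ X j y * ((b j)%:C - z - (a j ^+ 2)%:C * X j.+1 y) = 1,
         X' j y * ((b' j)%:C - z - (a' j ^+ 2)%:C * X' j.+1 y) = 1,
         `|X j.+1 y| <= (y%:C)^-1 & `|X' j.+1 y| <= (y%:C)^-1]) ->
  forall j, (j.+1 < J)%N -> a j = a' j /\ b j = b' j.
Proof.
move=> a0 X0 nearX.
suff H j : (j.+1 < J)%N -> (\forall y \near +oo%R, X j y = X' j y) ->
    [/\ a j = a' j, b j = b' j & \forall y \near +oo%R, X j.+1 y = X' j.+1 y].
  have G j : (j < J)%N -> \forall y \near +oo%R, X j y = X' j y.
    elim: j => // j IHj jJ; have [] // := H j jJ; exact: IHj (ltnW jJ).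
  by move=> j jJ; have [] := H j jJ (G j (ltnW jJ)).
move=> jJ Xj; have [aj aj'] := a0 j (ltnW jJ).
apply: (@cf_unique_step _ (a j) (b j) (a' j) (b' j) (a j.+1) (b j.+1) (a' j.+1)
  (b' j.+1) (X j) (X j.+1) (X j.+2) (X' j.+1) (X' j.+2)) => //.
near=> y.
have Xy : X j y = X' j y by near: y.
have Hy : forall i, (i < J)%N ->
     [/\ X i y * ((b i)%:C - (0 +i* y) - (a i ^+ 2)%:C * X i.+1 y) = 1,
         X' i y * ((b' i)%:C - (0 +i* y) - (a' i ^+ 2)%:C * X' i.+1 y) = 1,
         `|X i.+1 y| <= (y%:C)^-1 & `|X' i.+1 y| <= (y%:C)^-1] by near: y.
have [? E ? ?] := Hy j (ltnW jJ); have [? ? ? ?] := Hy j.+1 jJ.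
by split; split=> //; rewrite Xy.
Unshelve. all: by end_near. Qed.

(** * The reversed recurrence and the reflection *)

(** With argument [n] this is the number [W_(n+1)] of the overview. Reversal pairs [b n.+1] with
    [a n], so [a 0] enters at the first level. *)
Fixpoint cf_rev (R : realType) (a b : nat -> R) (w z : R[i]) n : R[i] :=
  if n is m.+1 then
    1 / ((b n)%:C - z - (a m ^+ 2)%:C * cf_rev a b w z m)
  else w.

Lemma cf_rev_bound (R : realType) (a b : nat -> R) (w z : R[i]) n :
  0 < 'Im z -> 0 <= 'Im w -> `|w| <= ('Im z)^-1 -> let W := cf_rev a b w z in
  [/\ 0 <= 'Im (W n), `|W n| <= ('Im z)^-1 &
      W n.+1 * ((b n.+1)%:C - z - (a n ^+ 2)%:C * W n) = 1].
Proof.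
move=> z0 Imw lew W.
have Im_W m : 0 <= 'Im (W m).
  by elim: m => // m IHm; have [] := cf_step (b m.+1) (a m) z0 IHm.
split=> //.
  by case: n => // n; have [] := cf_step (b n.+1) (a n) z0 (Im_W n).
by have [D0 _ _] := cf_step (b n.+1) (a n) z0 (Im_W n); rewrite /W /= divfK.
Qed.

(** Inverting the reversed recurrence restores the forward one. The sequence [T] is thus of the kind
    that [cf_tail_eq_quadratic] accepts. *)
Lemma cf_rev_tail (R : realType) (a b : nat -> R) (w z : R[i]) n :
  (forall n, a n != 0) ->
  0 < 'Im z -> 0 <= 'Im w -> `|w| <= ('Im z)^-1 -> w != 0 ->
  let T m := 1 / ((a m ^+ 2)%:C * cf_rev a b w z m) in
  T n * ((b n.+1)%:C - z - (a n.+1 ^+ 2)%:C * T n.+1) = 1.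
Proof.
move=> a0 z0 Imw lew w0 T.
have aC m : (a m ^+ 2)%:C != 0 :> R[i] by rewrite fmorph_eq0 expf_neq0.
have [_ _ WE] := cf_rev_bound a b n z0 Imw lew.
have W0 m : cf_rev a b w z m != 0.
  case: m => // m; have [_ _ E] := cf_rev_bound a b m z0 Imw lew.
  by apply/eqP => W0; move: E; rewrite W0 mul0r => /esym/eqP; rewrite oner_eq0.
have -> : (a n.+1 ^+ 2)%:C * T n.+1 = 1 / cf_rev a b w z n.+1.
  by rewrite /T !div1r invfM mulrA divff // mul1r.
have -> : 1 / cf_rev a b w z n.+1 = (b n.+1)%:C - z - (a n ^+ 2)%:C * cf_rev a b w z n.
  by rewrite -[in LHS]WE mulrC mulKf.
by rewrite subKr /T divfK // mulf_neq0.
Qed.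

(* The recurrence for the inverted tails uses [al 0]; the value [al k] encodes the
   factor [alpha_k ^ 2] in [1 / (alpha_k ^ 2 M')]. *)
Lemma cf_reflection (R : realType) (al be c d : nat -> R) (k p L : nat)
    (M : R[i] -> R[i]) (A B C : {poly R}) :
  (0 < p)%N -> (0 < L)%N -> al 0%N = al k -> (forall n, 0 < al n) -> (forall n, 0 < c n.+1) ->
  (forall n, (k <= n)%N -> al (n + p)%N = al n) ->
  (forall n, (k <= n)%N -> be (n + p)%N = be n) ->
  m_function_of al be M -> A != 0 ->
  (forall z, 0 < 'Im z -> peval A z * M z ^+ 2 + peval B z * M z + peval C z = 0) ->
  (forall z, 0 < 'Im z -> peval A z != 0 -> second_solution M A B z != 0 ->
     let w := 1 / ((al k ^+ 2)%:C * second_solution M A B z) in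
     porth c d L.-1 z * w + qorth c d L.-1 z != 0 ->
     M z = (porth c d L z * w + qorth c d L z)
           / (- (c L)%:C * (porth c d L.-1 z * w + qorth c d L.-1 z))) ->
  (forall n, (1 <= n)%N -> al (n + p)%N = al n /\ be (n + p)%N = be n) /\
  (forall i, (1 <= i)%N -> (L + i < p)%N ->
     al (p - L - i)%N = al i /\ be (p.+1 - L - i)%N = be i).
Proof.
(* From here on [L] is one less than the number of levels in the hypothesis. *)
move=> p0; case: L => // L _ al0k al0 c0 alP beP MM A0 AE ME.
have al1 n : al n.+1 != 0 by rewrite gt_eqF.
have c1 n : c n.+1 != 0 by rewrite gt_eqF.
pose x z := cf_tail al be (M z) z; pose M' := second_solution M A B.
pose w z := 1 / ((al k ^+ 2)%:C * M' z).
have alkC : (al k ^+ 2)%:C != 0 :> R[i] by rewrite fmorph_eq0 expf_neq0 // gt_eqF.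
have irr (P Q : {poly R}) : (P != 0) || (Q != 0) -> \forall y \near +oo%R,
    peval P (0 +i* y) * M (0 +i* y) + peval Q (0 +i* y) != 0.
  by apply: (@cf_not_rational R al be (fun n z => x z n) _ _ _ P Q 0%N) => // n z z0;
    have [] := cf_tail_bound n al1 MM z0.
have nearA : \forall y \near +oo%R, peval A (0 +i* y) != 0.
  have := irr 0 A; rewrite A0 orbT => /(_ isT); apply: filterS => y.
  by rewrite -polyC0 pevalC mul0r add0r.
have AM' z : peval A z != 0 -> peval A z * M' z = - (peval A z * M z + peval B z).
  by move=> Az; rewrite /M' /second_solution mulrBr mulrN mulrCA divff // mulr1 opprD addrC.
(* A zero of [M'] would be a zero of [A M + B], excluded far up the axis by irrationality. *)
have nearM' : \forall y \near +oo%R, M' (0 +i* y) != 0.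
  have := irr A B; rewrite A0 => /(_ isT) nearAB; near=> y.
  have Ay : peval A (0 +i* y) != 0 by near: y.
  have : peval A (0 +i* y) * M (0 +i* y) + peval B (0 +i* y) != 0 by near: y.
  by apply: contra_neq => M'0; apply: oppr_inj; rewrite -AM' // M'0 mulr0 oppr0.
have nearu : \forall y \near +oo%R, let z := 0 +i* y in
    porth c d L z * w z + qorth c d L z != 0.
  have [P [Q [P0 PQ]]] := porth_qorth_poly d L c1.
  (* These are the coefficients of the linear expression in [M] obtained from [P w + Q] by
     multiplying with [A (al k)^2 M'] and replacing [A M'] by [- (A M + B)]. *)
  have PQ0 : (- (al k ^+ 2)%:P * Q * A != 0) || (A * P - (al k ^+ 2)%:P * Q * B != 0).
    have [->|Q0] := eqVneq Q 0; first by rewrite !mulr0 !mul0r subr0 mulf_neq0 ?orbT.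
    by rewrite !mulf_neq0 // oppr_eq0 polyC_eq0 expf_neq0 // gt_eqF.
  apply: filterS3 nearA nearM' (irr _ _ PQ0) => y Ay M'y; rewrite !pevalE /=.
  have [-> ->] := PQ (0 +i* y); rewrite /w; have := AM' _ Ay; set z := 0 +i* y.
  move: (M' z) ((al k ^+ 2)%:C) M'y alkC => t s t0 s0 E.
  apply: contra_neq => u0; rewrite -[RHS](mulr0 (peval A z * (s * t))) -u0.
  transitivity (peval A z * peval P z + peval Q z * s * (peval A z * t)).
    by rewrite E; ring.
  by field; rewrite t0 s0.
have nearw : \forall y \near +oo%R, let z := 0 +i* y in
    w z = cf_ext c d L.+1 1 (M z) z.
  near=> y.
  have y0 : 0 < y by near: y; apply: nbhs_pinfty_gt; rewrite num_real.
  have z0 : 0 < 'Im (0 +i* y) :> R[i] by rewrite Im_imag ltcR.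
  have Az : peval A (0 +i* y) != 0 by near: y.
  have M'z : M' (0 +i* y) != 0 by near: y.
  have uz : porth c d L (0 +i* y) * w (0 +i* y) + qorth c d L (0 +i* y) != 0 by near: y.
  have [ImM _ _] := cf_tail_bound 0 al1 MM z0.
  apply: (mobius_cf_ext (c := c)) => //.
  have cL : (c L.+1)%:C != 0 :> R[i] by rewrite fmorph_eq0.
  by rewrite [M _]ME // -/(M' _) -/(w _) [RHS]mulrC divfK // mulf_neq0 // oppr_eq0.
pose good y := let z := 0 +i* y in
  [/\ 0 < 'Im z, w z != 0 & w z = cf_ext c d L.+1 1 (M z) z].
have near_good : \forall y \near +oo%R, good y.
  near=> y; split.
  - by rewrite Im_imag ltcR; near: y; apply: nbhs_pinfty_gt; rewrite num_real.
  - by rewrite /w div1r invr_eq0 mulf_neq0 //; near: y.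
  - by near: y.
have w_bound y : good y -> let z := 0 +i* y in 0 <= 'Im (w z) /\ `|w z| <= ('Im z)^-1.
  move=> [z0 _ E] /=; rewrite E; have [ImM leM _] := cf_tail_bound 0 al1 MM z0.
  by have [? H] := cf_ext_bound c d L.+1 1 z0 ImM; split=> //; apply: H.
pose W y := cf_rev al be (w (0 +i* y)) (0 +i* y).
have alneq0 n : al n != 0 by rewrite gt_eqF.
(* Equality of the tails of [M] at [k + p] and [k] is a quadratic relation, hence holds for [M']
   too. The inverted [W] solve the forward recurrence from [M'], so they also agree at these two
   indices. *)
have Wper : \forall y \near +oo%R, W y (k + p)%N = W y k.
  have [U [V [X UVX]]] := @cf_tail_eq_quadratic R al be (k + p)%N k al1.
  have nearU : \forall y \near +oo%R, let z := 0 +i* y in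
      peval U z * M' z ^+ 2 + peval V z * M' z + peval X z = 0.
    apply: (quadratic_conjugate (C := C)) => //.
      near=> y; apply: AE; rewrite Im_imag ltcR.
      by near: y; apply: nbhs_pinfty_gt; rewrite num_real.
    near=> y; set z := 0 +i* y.
    have z0 : 0 < 'Im z.
      by rewrite Im_imag ltcR; near: y; apply: nbhs_pinfty_gt; rewrite num_real.
    apply/eqP; rewrite -(UVX z (x z)); first by apply/eqP; apply: cf_tail_periodic.
    by move=> n; have [] := cf_tail_bound n al1 MM z0.
  near=> y; have gy : good y by near: y.
  have [Imw lew] := w_bound _ gy; have [z0 w0 _] := gy.
  have TE n := cf_rev_tail be n alneq0 z0 Imw lew w0.
  have T0 : 1 / ((al 0%N ^+ 2)%:C * w (0 +i* y)) = M' (0 +i* y).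
    by rewrite /w al0k !div1r invfM invrK mulKf.
  have := UVX _ _ TE; rewrite /= T0.
  have -> : peval U (0 +i* y) * M' (0 +i* y) ^+ 2 + peval V (0 +i* y) * M' (0 +i* y)
      + peval X (0 +i* y) = 0 by near: y.
  rewrite eqxx !div1r alP // => /eqP/invr_inj/mulfI; apply.
  by rewrite fmorph_eq0 expf_neq0.
(* Two expansions of the same number: [X] reads backwards from [k + p]. [X'] reads backwards from
   [k] to 0, then through the finite fraction of [w], then forwards along the tails of [M]. *)
pose X j y := W y (k + p - j)%N.
pose X' j y := let z := 0 +i* y in
  if (j < k)%N then W y (k - j)%N
  else if (j < k + L.+1)%N then cf_ext c d (L.+1 - (j - k)) (j - k).+1 (M z) z
  else x z (j - k - L.+1)%N.
pose a' j := if (j < k)%N then al (k - j.+1)%N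
  else if (j < k + L.+1)%N then c (j - k).+1 else al (j - k - L)%N.
pose b' j := if (j < k)%N then be (k - j)%N
  else if (j < k + L.+1)%N then d (j - k).+1 else be (j - k - L)%N.
have key : forall j, (j.+1 < k + p)%N ->
    al (k + p - j.+1)%N = a' j /\ be (k + p - j)%N = b' j.
  apply: (@cf_unique R (fun j => al (k + p - j.+1)%N) (fun j => be (k + p - j)%N)
    a' b' X X' (k + p)).
  - by move=> j _; split=> //; rewrite /a'; do 2 case: ifP => // _.
  - near=> y; rewrite /X /X' !subn0.
    have -> : W y (k + p)%N = W y k by near: y.
    (* For [k = 0] the backward segment of [X'] is empty and it starts with the finite fraction. *)
    case: (posnP k) => [->|//]; rewrite add0n ltn0Sn.
    by have [_ _] : good y by near: y.
  near=> y; have gy : good y by near: y.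
  have [z0 _ wE] := gy; have [Imw lew] := w_bound _ gy.
  set z := 0 +i* y in z0 wE Imw lew *.
  have [ImM leM _] := cf_tail_bound 0 al1 MM z0.
  have Wb n := cf_rev_bound al be n z0 Imw lew.
  have yE : (y%:C)^-1 = ('Im z)^-1 :> R[i] by rewrite Im_imag.
  (* Each formula includes the junction with the next segment, as the recurrence at the last index
     of a segment needs it. *)
  have X1 j : (j <= k)%N -> X' j y = W y (k - j)%N.
    rewrite leq_eqVlt /X' => /predU1P[->|->//].
    by rewrite ltnn subnn addnS ltnS leq_addr subn0; symmetry.
  have X2 j : (j <= L.+1)%N -> X' (k + j)%N y = cf_ext c d (L.+1 - j) j.+1 (M z) z.
    rewrite leq_eqVlt => /predU1P jL; rewrite /X' ltnNge leq_addr /= ltn_add2l addKn.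
    by case: jL => [->|->//]; rewrite ltnn subnn.
  have X3 j : X' (k + L.+1 + j)%N y = x z j.
    rewrite /X' -addnA ltnNge leq_addr /= ltn_add2l ltnNge leq_addr /=.
    by rewrite addKn addKn.
  move=> j jJ; rewrite yE.
  have [WXr WXb] : X j y * ((be (k + p - j)%N)%:C - z -
        (al (k + p - j.+1)%N ^+ 2)%:C * X j.+1 y) = 1 /\ `|X j.+1 y| <= ('Im z)^-1.
    rewrite /X (_ : (k + p - j = (k + p - j.+1).+1)%N); last by lia.
    by have [_ ? ?] := Wb (k + p - j.+1)%N.
  suff [? ?] : X' j y * ((b' j)%:C - z - (a' j ^+ 2)%:C * X' j.+1 y) = 1 /\
      `|X' j.+1 y| <= ('Im z)^-1 by [].
  have [jk|kj] := ltnP j k.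
    rewrite !X1 ?(ltnW jk) // /a' /b' jk (_ : (k - j = (k - j.+1).+1)%N); last by lia.
    by have [_ ? ?] := Wb (k - j.+1)%N.
  have [i jE] : exists i, j = (k + i)%N by exists (j - k)%N; lia.
  rewrite {}jE in jJ kj *; rewrite /a' /b' ltnNge leq_addr /= ltn_add2l addKn -addnS.
  have [iL|Li] := ltnP i L.+1.
    rewrite !X2 ?(ltnW iL) // (_ : (L.+1 - i = (L.+1 - i.+1).+1)%N); last by lia.
    split; first exact: cf_ext_rel.
    by have [_ H] := cf_ext_bound c d (L.+1 - i.+1) i.+2 z0 ImM; apply: H.
  have [h iE] : exists h, i = (L.+1 + h)%N by exists (i - L.+1)%N; lia.
  rewrite {}iE in jJ kj Li *; rewrite -addnS !addnA !X3.
  rewrite (_ : (L.+1 + h - L = h.+1)%N); last by lia.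
  have [_ _ xr] := cf_tail_bound h al1 MM z0; split=> //.
  by have [] := cf_tail_bound h.+1 al1 MM z0.
split=> [n n0|i i0 Lip].
  have [kn|nk] := leqP k n; first by rewrite alP ?beP.
  (* Below [k], the first segment of [X'] extends the period down to index 1; the [al] and [be] of
     index [n] occur one level apart. *)
  have [nE _] := key (k - n.+1)%N ltac:(lia); have [_ nE'] := key (k - n)%N ltac:(lia).
  move: nE nE'; rewrite /a' /b' !ifT; try lia.
  rewrite (_ : (k + p - (k - n.+1).+1 = n + p)%N); last by lia.
  rewrite (_ : (k - (k - n.+1).+1 = n)%N); last by lia.
  rewrite (_ : (k + p - (k - n) = n + p)%N); last by lia.
  by rewrite (_ : (k - (k - n) = n)%N); last by lia.
(* This level lies in the third segment, where backward and forward readings of the sequence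
   meet. *)
have := key (k + L + i)%N ltac:(lia); rewrite /a' /b' !ifF; try lia.
rewrite (_ : (k + p - (k + L + i).+1 = p - L.+1 - i)%N); last by lia.
rewrite (_ : (k + p - (k + L + i) = p.+1 - L.+1 - i)%N); last by lia.
by rewrite (_ : (k + L + i - k - L = i)%N); last by lia.
Unshelve. all: by end_near. Qed.

(** * Eventually periodic coefficients and the two palindromes *)

(** The case [n = k] rests on [alpha k = a p], since [k + p] is the last index of the first
    block. *)
Lemma ev_per_periodic (R : realType) (alpha a : nat -> R) k p n :
  (0 < p)%N -> alpha k = a p -> (k <= n)%N ->
  ev_per alpha a k p (n + p) = ev_per alpha a k p n.
Proof.
move=> p0 kp; rewrite leq_eqVlt => /predU1P[<-|kn].
  rewrite /ev_per leqnn ifF; last by lia.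
  rewrite (_ : k + p - k - 1 = p.-1)%N; last by lia.
  by rewrite modn_small ?prednK // addn1 prednK //; symmetry.
rewrite /ev_per !ifF; try by lia.
by rewrite (_ : n + p - k - 1 = n - k - 1 + p)%N ?modnDr //; lia.
Qed.

Lemma ev_per_gt0 (R : realType) (alpha a : nat -> R) k p n : (0 < p)%N ->
  (forall j : nat, (1 <= j <= k)%N -> 0 < alpha j) ->
  (forall j : nat, (1 <= j <= p)%N -> 0 < a j) ->
  (0 < n)%N -> 0 < ev_per alpha a k p n.
Proof.
move=> p0 alpha0 a0 n0; rewrite /ev_per; case: leqP => nk.
  by apply: alpha0; rewrite n0.
by apply: a0; rewrite addn1 ltn_mod p0.
Qed.

Theorem theorem3p1 (R : realType)
  (alpha beta a b : nat -> R) (k p : nat) (M : R[i] -> R[i])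
  (A B Cp : {poly R}) (c d : nat -> R) (L : nat) :
  (1 <= k)%N -> (1 <= p)%N ->
  (forall j : nat, (1 <= j <= k)%N -> 0 < alpha j) ->
  (forall j : nat, (1 <= j <= p)%N -> 0 < a j) ->
  alpha k = a p -> beta k = b p ->
  m_function_of (ev_per alpha a k p) (ev_per beta b k p) M ->
  minimal_quad_rel M A B Cp ->
  (forall n : nat, (1 <= n)%N -> 0 < c n) ->
  (1 <= L)%N ->
  (forall z : R[i], 0 < Im z ->
     peval A z != 0 ->
     second_solution M A B z != 0 ->
     let w := 1 / ((alpha k ^+ 2)%:C * second_solution M A B z) in
     porth c d L.-1 z * w + qorth c d L.-1 z != 0 ->
     M z = (porth c d L z * w + qorth c d L z)
           / (- (c L)%:C * (porth c d L.-1 z * w + qorth c d L.-1 z))) ->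
  exists q l : nat,
    doubly_palindromic_with (ev_per alpha a k p) (ev_per beta b k p) q l.
Proof.
move=> k0 p0 alpha0 a0 kpa kpb MM [A0 AE _] c0 L0 ME.
(* The value at 0 provides [al 0 = al k]; the fraction of [M] starts at index 1 and is
   unaffected. *)
pose al n := if n is 0 then alpha k else ev_per alpha a k p n.
pose be := ev_per beta b k p.
have alk : al k = alpha k by rewrite /al /ev_per leqnn; case: (k).
have alS n : (0 < n)%N -> al n = ev_per alpha a k p n by case: n.
have al0 n : 0 < al n.
  case: n => [|n]; first by apply: alpha0; rewrite k0 leqnn.
  exact: ev_per_gt0.
have alP t n : (k <= n)%N -> al (n + p * t)%N = al n.
  move=> kn; elim: t => [|t IHt]; first by rewrite muln0 addn0.
  rewrite -IHt mulnS [(p + _)%N]addnC addnA !alS ?addn_gt0; try by lia.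
  by rewrite ev_per_periodic // (leq_trans kn) // leq_addr.
have beP t n : (k <= n)%N -> be (n + p * t)%N = be n.
  move=> kn; elim: t => [|t IHt]; first by rewrite muln0 addn0.
  rewrite -IHt mulnS [(p + _)%N]addnC addnA.
  by rewrite /be ev_per_periodic // (leq_trans kn) // leq_addr.
have MM' : m_function_of al be M.
  move=> z z0.
  under eq_fun do rewrite (@cf_trunc_eq R al be (ev_per alpha a k p) be _ 1 1) //.
  exact: MM.
have pt0 t : (0 < t)%N -> (0 < p * t)%N by rewrite muln_gt0 p0.
rewrite -alk in ME.
have refl t (t0 : (0 < t)%N) := cf_reflection (pt0 t t0) L0 (esym alk) al0
  (fun n => c0 n.+1 isT) (alP t) (beP t) MM' A0 AE ME.
(* [p] may be smaller than [L]; this multiple leaves room for both blocks. Reflecting with period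
   [q + q] covers every pair of indices in one period. *)
pose q := (p * L.+2)%N.
have qL : (L.+2 <= q)%N by rewrite /q leq_pmull.
have [per _] := refl L.+2 isT; have [_ rfl] := refl (2 * L.+2)%N isT.
rewrite -/q in per; rewrite (_ : p * (2 * L.+2) = q + q)%N in rfl; last by rewrite /q; lia.
have rflA i j : (0 < i)%N -> (0 < j)%N -> (i + j = q + q - L)%N -> al i = al j.
  move=> i0 j0 ij; have [<- _] := rfl j j0 ltac:(lia).
  by congr al; lia.
have rflB i j : (0 < i)%N -> (1 < j)%N -> (i + j = (q + q).+1 - L)%N -> be j = be i.
  move=> i0 j0 ij; have [_ <-] := rfl i i0 ltac:(lia).
  by congr be; lia.
(* Modulo [q], indices of [al] are paired with sum [- L] and those of [be] with sum [1 - L]. The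
   blocks starting at 1 have end sums [q - L] and [q - L + 1], so one index is first shifted by [q];
   the later blocks have the sums [2 q - L] and [2 q - L + 1] directly. *)
exists q, (q - L).-1; split; try by lia.
- split; first by lia.
  by move=> n n0; have [] := per n n0; rewrite !alS ?addn_gt0 ?n0.
- split=> i il; rewrite -!alS; try by lia.
    have [<- _] := per (1 + ((q - L).-1 - 1 - i))%N isT; apply: rflA; lia.
  by apply: rflA; lia.
- split=> i il; rewrite -/be.
    have [_ <-] := per (1 + i)%N isT; apply: rflB; lia.
  by apply: rflB; lia.
Qed.
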